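(* Let $n\ge 3$ and $d\ge 1$ be integers. Then (a) $P(n,2,d)\ge 3$ if $d\le n+\lfloor n/3\rfloor-2$; and (b) $P(n,2,d)\ge 5$ if $d\le n-2$.
   Context: For permutations $\sigma,\pi$ of $[1\ldots n]=\{1,\dots,n\}$, the Kendall-$\tau$ distance $d(\sigma,\pi)$ is the minimum number of adjacent transpositions needed to transform $\sigma$ into $\pi$. $S_{n,2}$ is the set of permutations of $[1\ldots n]$ in which the symbols $1,\dots,n-2$ appear in increasing order. An $(n,2,d)$-array is a subset of $S_{n,2}$ whose pairwise Kendall-$\tau$ distances are all at least $d$, and $P(n,2,d)$ is the maximum cardinality of an $(n,2,d)$-array. *)

(* Defs.v *)
From mathcomp Require Import all_boot all_fingroup.

Set Implicit Arguments.
Unset Strict Implicit.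
Unset Printing Implicit Defensive.

Local Open Scope group_scope.

(* A permutation s : 'S_n is read as the word s(0) s(1) ... s(n-1): s sends
   positions to symbols and s^-1 sends symbols to positions. The ordinal
   i : 'I_n stands for the symbol (or position) i + 1 of [1 .. n]. *)

(* Since (s * t) x = t (s x) in 'S_n, the word of tperm i j * s is the word of
   s with the entries at *positions* i and j exchanged. *)
Definition adj_swap (n : nat) : rel 'S_n := fun s t =>
  [exists i : 'I_n, exists j : 'I_n,
    (nat_of_ord j == i.+1) && (t == tperm i j * s)].

Definition adj_reach (n k : nat) (s t : 'S_n) : bool :=
  [exists p : k.-tuple 'S_n, path (@adj_swap n) s p && (last s p == t)].

Lemma connect_tperm (n : nat) (s : 'S_n) (i j : 'I_n) :
  connect (@adj_swap n) s (tperm i j * s).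
Proof.
suff H m (a b : 'I_n) u :
    nat_of_ord b = a + m -> connect (@adj_swap n) u (tperm a b * u).
  case: (leqP i j) => [le_ij | lt_ji]; first by apply: (H (j - i)); rewrite subnKC.
  by rewrite tpermC; apply: (H (i - j)); rewrite subnKC // ltnW.
elim: m b u => [|m IHm] b u eq_b.
  have -> : b = a by apply: val_inj; rewrite /= eq_b addn0.
  by rewrite tperm1 mul1g connect0.
have lt_c : a + m < n by rewrite (leq_trans _ (ltnW (ltn_ord b))) // eq_b addnS.
pose c := Ordinal lt_c.
have swap_cb v : connect (@adj_swap n) v (tperm c b * v).
  apply: connect1; apply/existsP; exists c; apply/existsP; exists b.
  by rewrite eqxx andbT eq_b addnS.
case: (posnP m) => [m0 | m_gt0].
  have -> : a = c by apply: val_inj; rewrite /= m0 addn0.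
  exact: swap_cb.
have neq_ca : c != a by rewrite -val_eqE /= -[X in _ != X]addn0 eqn_add2l -lt0n.
have neq_ba : b != a by rewrite -val_eqE /= eq_b -[X in _ != X]addn0 eqn_add2l.
have -> : tperm a b = tperm c b * tperm a c * tperm c b.
  rewrite -[X in X * _ * _]tpermV -mulgA -conjgE tpermJ tpermL tpermD //.
rewrite -!mulgA.
apply: connect_trans (swap_cb u) _.
by apply: connect_trans (IHm c _ _) (swap_cb _).
Qed.

Lemma adj_reach_ex (n : nat) (s t : 'S_n) : exists k, adj_reach k s t.
Proof.
have: connect (@adj_swap n) s t.
  have -> : t = (t * s^-1) * s by rewrite mulgKV.
  case: (prod_tpermP (t * s^-1)) => ts -> _.
  elim: ts => [|[i j] ts IHts]; first by rewrite big_nil mul1g connect0.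
  rewrite big_cons -mulgA.
  exact: connect_trans IHts (connect_tperm _ _ _).
case/connectP=> p p_path t_last; exists (size p).
by apply/existsP; exists (in_tuple p); rewrite p_path -t_last eqxx.
Qed.

Definition kendall (n : nat) (s t : 'S_n) : nat := ex_minn (adj_reach_ex s t).

(* The symbols 1, ..., n - 2 are the ordinals below n - 2; the word of s lists
   them in increasing order when their positions increase. *)
Definition Sn2 (n : nat) : {set 'S_n} :=
  [set s : 'S_n | [forall i : 'I_n, forall j : 'I_n,
     [&& i < n - 2, j < n - 2 & i < j] ==> (s^-1 i < s^-1 j)]].

Definition is_array2 (n d : nat) (A : {set 'S_n}) : bool :=
  (A \subset Sn2 n) &&
  [forall s in A, forall t in A, (s != t) ==> (d <= kendall s t)].

Definition P2 (n d : nat) : nat := \max_(A : {set 'S_n} | is_array2 d A) #|A|.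

(* Main.v *)
Require Import Defs.
From mathcomp Require Import all_boot all_fingroup.
From mathcomp Require Import zify.

(** The Kendall distance is bounded below by the number of pairs of symbols that
    the two words list in opposite orders. A word of [Sn2 m.+2] is determined by
    the numbers i, j of symbols among 1 .. m preceding the two free symbols
    x = m + 1 and y = m + 2, together with the bit w telling whether x precedes
    y; two such words disagree on |i - i'| + |j - j'| + (w != w') pairs. Hence
    the question is about spread-out points of the square [0, m]^2 in the l1
    metric, with a bonus of 1 when the bits differ. For (a) take (0, 0),
    (m, q - 1) and (q, m) with q = n / 3; for (b) take the four corners and the
    centre, whose bit is chosen opposite to that of (0, 0). *)

Definition discord {n : nat} (s t : 'S_n) : nat :=
  \sum_(b < n) \sum_(a < n | a < b)
     ((s^-1 a < s^-1 b) != (t^-1 a < t^-1 b))%g.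

Lemma discord_refl (n : nat) (s : 'S_n) : discord s s = 0.
Proof. by apply: big1 => b _; apply: big1 => a _; rewrite eqxx. Qed.

Lemma discord_sym (n : nat) (s t : 'S_n) : discord s t = discord t s.
Proof.
by apply: eq_bigr => b _; apply: eq_bigr => a _; rewrite [in LHS]eq_sym.
Qed.

Lemma discord_triangle (n : nat) (s t u : 'S_n) :
  discord s u <= discord s t + discord t u.
Proof.
rewrite -big_split /=; apply: leq_sum => b _.
rewrite -big_split /=; apply: leq_sum => a _.
by case: (_ < _)%N; case: (_ < _)%N; case: (_ < _)%N.
Qed.

(** Any position other than [i] and [i.+1] compares the same way with both, so only the two symbols
    standing there change their relative order. *)
Lemma discord_adj_swap (n : nat) (s t : 'S_n) :
  adj_swap s t -> discord s t <= 1.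
Proof.
case/existsP=> i /existsP[j /andP[/eqP ji /eqP ->]].
(* The only pair that can count, sorted because [discord] ranges over a < b. *)
pose lo := if s i < s j then s i else s j.
pose hi := if s i < s j then s j else s i.
have sub (a b : 'I_n) : a < b ->
    ((s^-1 a < s^-1 b) != ((tperm i j * s)^-1 a < (tperm i j * s)^-1 b))%g ->
    (b == hi) && (a == lo).
  rewrite invMg tpermV !permM /lo /hi.
  set p := (s^-1)%g a; set q := (s^-1)%g b.
  have -> : a = s p by rewrite permKV.
  have -> : b = s q by rewrite permKV.
  move=> lt_spq.
  have neq_pq : p != q by apply: contraTneq lt_spq => ->; rewrite ltnn.
  have tpermE x : tperm i j x = (if x == i :> nat then nat_of_ord j
      else if x == j :> nat then nat_of_ord i else nat_of_ord x) :> nat.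
    by rewrite permE /= -!val_eqE /=; case: ifP => // _; case: ifP.
  rewrite !tpermE => differ.
  have [] : p = i /\ q = j \/ p = j /\ q = i.
    suff: p = i :> nat /\ q = j :> nat \/ p = j :> nat /\ q = i :> nat.
      by case=> -[/val_inj p_val /val_inj q_val]; [left | right].
    move: neq_pq differ; rewrite -val_eqE /= {tpermE}.
    move: (p : nat) (q : nat) (i : nat) (j : nat) ji => p0 q0 i0 j0 ->.
    by do !(case: ifP => ?); lia.
  - by move=> [pi qj]; move: lt_spq; rewrite pi qj => ->; rewrite !eqxx.
  - move=> [pj qi]; move: lt_spq; rewrite pj qi => lt_ji.
    by rewrite ltnNge (ltnW lt_ji) /= !eqxx.
apply: leq_trans (_ : \sum_(b < n | b == hi) \sum_(a < n | a == lo) 1 <= 1).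
  rewrite [leqRHS]big_mkcond; apply: leq_sum => b _.
  have [/= b_hi | b_hi] := boolP (b == hi); last first.
    rewrite leqn0; apply/eqP/big1 => a lt_ab; apply/eqP.
    by rewrite eqb0; apply: contraNN b_hi => /(sub a b lt_ab)/andP[].
  rewrite big_mkcond [leqRHS]big_mkcond; apply: leq_sum => a _.
  case: ifP => // lt_ab; case: eqP => //= neq.
  have /(sub a b lt_ab)/andP[_ ->] // := introN eqP neq.
by rewrite !big_pred1_eq.
Qed.

Lemma discord_path (n : nat) (s : 'S_n) (p : seq 'S_n) :
  path (@adj_swap n) s p -> discord s (last s p) <= size p.
Proof.
elim: p s => [|t p IHp] s /=; first by rewrite discord_refl.
case/andP=> /discord_adj_swap st /IHp.
by have := discord_triangle _ s t (last t p); lia.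
Qed.

Lemma discord_le_kendall (n : nat) (s t : 'S_n) : discord s t <= kendall s t.
Proof.
rewrite /kendall; case: ex_minnP => k /existsP[p /andP[/discord_path + /eqP <-]] _.
by rewrite size_tuple.
Qed.

(** Since [discord s s] is 0 and [d] is positive, a pairwise far list has no repetitions, so its
    size is the cardinality of the array it lists. *)
Lemma size_le_P2 (n d : nat) (ss : seq 'S_n) : 0 < d ->
  all [in Sn2 n] ss -> pairwise (fun s t => d <= discord s t) ss ->
  size ss <= P2 n d.
Proof.
move=> d_gt0 ssS ss_far.
have ss_uniq : uniq ss.
  apply: pairwise_uniq ss_far => s /=.
  by rewrite discord_refl leqNgt d_gt0.
have <- : #|[set s in ss]| = size ss.
  by rewrite cardsE; apply/card_uniqP.
apply: (@leq_bigmax_cond _ (@is_array2 n d) (fun A : {set 'S_n} => #|A|)).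
apply/andP; split.
  by apply/subsetP => s; rewrite inE => /(allP ssS).
pose r := [rel s t : 'S_n | (s != t) ==> (d <= discord s t)].
have : all2rel r ss.
  rewrite -pairwise_all2rel.
  - by apply: sub_pairwise ss_far => s t far; apply/implyP.
  - by move=> s; rewrite /r /= eqxx.
  - by move=> s t; rewrite /r /= eq_sym discord_sym.
move/allrelP=> ss_r; apply/forall_inP => s; rewrite inE => s_in.
apply/forall_inP => t; rewrite inE => t_in; apply/implyP => neq_st.
have /implyP/(_ neq_st) /= := ss_r s t s_in t_in.
by move/leq_trans; apply; apply: discord_le_kendall.
Qed.

(* The position of the symbol c in the word coded by (i, j, w); when i = j the
   two free symbols are adjacent and only w tells their order. *)
Definition slot (m i j : nat) (w : bool) (c : nat) : nat :=
  if c < m then c + (i <= c) + (j <= c)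
  else if c == m then i + ~~ w else j + w.

(** If x precedes y, every symbol before x is also before y; hence the inequality tied to [w]. Both
    bits are allowed when [i = j]. *)
Definition has_slots {m : nat} (i j : nat) (w : bool) (s : 'S_m.+2) : Prop :=
  [/\ i <= m, j <= m, if w then i <= j else j <= i
    & forall c : 'I_m.+2, (s^-1)%g c = slot m i j w c :> nat].

Lemma ex_has_slots (m i j : nat) (w : bool) :
  i <= m -> j <= m -> (if w then i <= j else j <= i) ->
  exists s : 'S_m.+2, has_slots i j w s.
Proof.
move=> im jm ijw.
have ltS (c : 'I_m.+2) : slot m i j w c < m.+2.
  by have := ltn_ord c; rewrite /slot; do !(case: ifP => ?); case: w ijw; lia.
have inj : injective (fun c => Ordinal (ltS c)).
  move=> a b [] eq_ab; apply: val_inj; move: eq_ab; rewrite /slot /=.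
  have := ltn_ord a; have := ltn_ord b.
  by do !(case: ifP => ?); case: w ijw {ltS}; lia.
(* [slot] goes from symbols to positions, a word from positions to symbols. *)
by exists (perm inj)^-1%g; split=> // c; rewrite invgK permE.
Qed.

Lemma has_slots_Sn2 (m i j : nat) (w : bool) (s : 'S_m.+2) :
  has_slots i j w s -> s \in Sn2 m.+2.
Proof.
move=> [_ _ _ sP]; rewrite inE; apply/forallP => a; apply/forallP => b.
by apply/implyP; rewrite !sP /slot; do !(case: ifP => ?); lia.
Qed.

Lemma sum_ltn_neq (m i k : nat) : i <= m -> k <= m ->
  \sum_(c < m) ((c < i) != (c < k)) = (i - k) + (k - i).
Proof.
(* With [minn m] the identity needs no bounds on [i] and [k], so induction on [m] applies. *)
suff -> : \sum_(c < m) ((c < i) != (c < k)) =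
          (minn m i - minn m k) + (minn m k - minn m i) by lia.
by elim: m => [|m IHm]; rewrite ?big_ord0 ?big_ord_recr /= ?IHm; lia.
Qed.

Lemma discord_has_slots {m i j i' j' : nat} {w w' : bool} {s t : 'S_m.+2} :
  has_slots i j w s -> has_slots i' j' w' t ->
  (i - i') + (i' - i) + ((j - j') + (j' - j)) + (w != w') <= discord s t.
Proof.
move=> [im jm ijw sP] [im' jm' ijw' tP].
rewrite -(sum_ltn_neq m i i') // -(sum_ltn_neq m j j') //.
(* The rows [b = m] and [b = m.+1] hold the pairs involving x or y; the pairs within 1 .. m are
   dropped. *)
rewrite /discord 2!big_ord_recr /= -!addnA.
apply: leq_trans (leq_addl _ _).
rewrite !(big_mkcond (fun a : 'I__ => a < _)) !big_ord_recr /=.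
rewrite -!addnA; apply: leq_add.
  apply: leq_sum => c _.
  rewrite !sP !tP /slot /=; have := ltn_ord c.
  by do !(case: ifP => ?); case: w ijw {sP}; case: w' ijw' {tP}; lia.
(* In the row of x, the terms for a = x and a = y vanish, as a < b fails. *)
do 2!apply: leq_trans (leq_addl _ _).
apply: leq_add.
  apply: leq_sum => c _.
  rewrite !sP !tP /slot /=; have := ltn_ord c.
  by do !(case: ifP => ?); case: w ijw {sP}; case: w' ijw' {tP}; lia.
rewrite !sP !tP /slot /=.
by do !(case: ifP => ?); case: w ijw {sP}; case: w' ijw' {tP}; lia.
Qed.

Theorem theorem8 (n d : nat) (hn : 3 <= n) (hd : 1 <= d) :
  (d <= n + n %/ 3 - 2 -> 3 <= P2 n d) /\ (d <= n - 2 -> 5 <= P2 n d).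
Proof.
case: n hn => [|[|m]] // hm; have slots := @ex_has_slots m.
have wordP := @has_slots_Sn2 m.
split=> d_le.
  (* The first word is at distance m + q from both others, the bit making up for [q.-1]. The other
     two are 2m - 2q + 2 apart, which is at least m + q because 3q <= m + 2. *)
  pose q := m.+2 %/ 3.
  have [s1 H1] : exists s : 'S_m.+2, has_slots 0 0 true s by apply: slots.
  have [s2 H2] : exists s : 'S_m.+2, has_slots m q.-1 false s by apply: slots; lia.
  have [s3 H3] : exists s : 'S_m.+2, has_slots q m true s by apply: slots; lia.
  apply: (@size_le_P2 _ _ [:: s1; s2; s3]) => //.
    by rewrite /= (wordP _ _ _ _ H1) (wordP _ _ _ _ H2) (wordP _ _ _ _ H3).
  rewrite /= !andbT -!andbA; apply/and3P; split.
  - by apply: leq_trans (discord_has_slots H1 H2); lia.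
  - by apply: leq_trans (discord_has_slots H1 H3); lia.
  - by apply: leq_trans (discord_has_slots H2 H3); lia.
have [s1 H1] : exists s : 'S_m.+2, has_slots 0 0 true s by apply: slots.
have [s2 H2] : exists s : 'S_m.+2, has_slots 0 m true s by apply: slots.
have [s3 H3] : exists s : 'S_m.+2, has_slots m 0 false s by apply: slots.
have [s4 H4] : exists s : 'S_m.+2, has_slots m m true s by apply: slots.
(* For odd m the rounded centre is only m - 1 away from (0, 0) in the l1 metric; the opposite bit
   supplies the missing 1. *)
have [s5 H5] : exists s : 'S_m.+2, has_slots m./2 m./2 false s by apply: slots; lia.
apply: (@size_le_P2 _ _ [:: s1; s2; s3; s4; s5]) => //.
  by rewrite /= (wordP _ _ _ _ H1) (wordP _ _ _ _ H2) (wordP _ _ _ _ H3)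
             (wordP _ _ _ _ H4) (wordP _ _ _ _ H5).
rewrite /= !andbT -!andbA; do !(apply/andP; split).
- by apply: leq_trans (discord_has_slots H1 H2); lia.
- by apply: leq_trans (discord_has_slots H1 H3); lia.
- by apply: leq_trans (discord_has_slots H1 H4); lia.
- by apply: leq_trans (discord_has_slots H1 H5); lia.
- by apply: leq_trans (discord_has_slots H2 H3); lia.
- by apply: leq_trans (discord_has_slots H2 H4); lia.
- by apply: leq_trans (discord_has_slots H2 H5); lia.
- by apply: leq_trans (discord_has_slots H3 H4); lia.
- by apply: leq_trans (discord_has_slots H3 H5); lia.
- by apply: leq_trans (discord_has_slots H4 H5); lia.
Qed.
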